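(* Let $(d_i)_{i\ge 0}$ be a sequence of integers with $d_i\ge 2$, and let $A=(a_0,\ldots,a_k)$ be a normal $\{d_i\}$-collection. Let $j_1<j_2<\cdots<j_s=k$ be all the critical indices of $A$, put $j_0=-1$, and let $A_1,\ldots,A_s$ be the decomposition of $A$ in which $A_i$ consists of those tokens $p_t$ of $A$ (with their multiplicity $a_t$) for which $j_{i-1}<t\le j_i$. Then $$\mathrm{span}(A)=\bigoplus_{i=1}^s p_{j_{i-1}+1}\cdot\left\{0,1,\ldots,\frac{\mathrm{sum}(A_i)}{p_{j_{i-1}+1}}\right\},$$ where $\oplus$ denotes a direct sum: $\mathrm{span}(A)$ is the set of all sums $x_1+\cdots+x_s$ with $x_i\in p_{j_{i-1}+1}\cdot\{0,1,\ldots,\mathrm{sum}(A_i)/p_{j_{i-1}+1}\}$ for each $i$, and every element of $\mathrm{span}(A)$ is uniquely represented in this form.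
   Context: Put $p_0=1$ and $p_{i+1}=d_ip_i$ for $i\ge 0$. A $\{d_i\}$-collection is a finite multiset of numbers $p_i$, written $A=(a_0,a_1,\ldots,a_k)$ with $a_i\in\mathbb{Z}_{\ge 0}$ and $a_k\ne 0$, where $a_i$ is the multiplicity of $p_i$ in $A$ (copies of $p_i$ are called tokens $p_i$). For a finite multiset $C$ of positive integers, $\mathrm{sum}(C)$ is the sum of its elements with multiplicity (so $0$ if $C$ is empty). $\mathrm{span}(A)=\{\sum_{i=0}^k c_ip_i : c_i\in\mathbb{Z},\ 0\le c_i\le a_i\}$, i.e. the set of sums of all submultisets of $A$. $A$ is normal if $a_i\le 2(d_i-1)$ for all $i$. An index $j\in\{0,\ldots,k\}$ is critical if either $j=k$ or $a_j<d_j-1$. For a set $S$ of integers and an integer $p$, $p\cdot S=\{ps: s\in S\}$. *)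

(* Defs.v *)
From mathcomp Require Import all_boot all_order all_algebra.
From mathcomp Require Import classical_sets.
Set Implicit Arguments.
Unset Strict Implicit.
Unset Printing Implicit Defensive.
Import Order.TTheory GRing.Theory Num.Theory.
Local Open Scope classical_set_scope.

(* p_0 = 1, p_(i+1) = d_i p_i. *)
Definition tok (d : nat -> nat) (i : nat) : nat := \prod_(t < i) d t.

(* A multiset of tokens p_0, ..., p_k is given by its multiplicities
   a : {ffun 'I_k.+1 -> nat}.  It is a {d_i}-collection when moreover
   a ord_max != 0; the pieces of the decomposition below need not satisfy this
   and may even be empty. *)

Definition ms_sum (d : nat -> nat) (k : nat) (a : {ffun 'I_k.+1 -> nat}) : nat :=
  \sum_(i < k.+1) a i * tok d i.

Definition ms_span (d : nat -> nat) (k : nat) (a : {ffun 'I_k.+1 -> nat}) :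
    set int :=
  [set n | exists2 c : {ffun 'I_k.+1 -> int},
     (forall i, (0 <= c i <= (a i)%:Z)%R) &
     n = (\sum_(i < k.+1) c i * (tok d i)%:Z)%R].

Definition ms_normal (d : nat -> nat) (k : nat) (a : {ffun 'I_k.+1 -> nat}) :
    Prop :=
  forall i : 'I_k.+1, a i <= 2 * (d i - 1).

Definition critical (d : nat -> nat) (k : nat) (a : {ffun 'I_k.+1 -> nat}) :
    pred 'I_k.+1 :=
  fun j => (j == ord_max) || (a j < d j - 1).

(* The critical indices in increasing order.  Positions in this list start at 0,
   so the i-th entry is j_(i+1) of the usual numbering j_1 < ... < j_s. *)
Definition crits (d : nat -> nat) (k : nat) (a : {ffun 'I_k.+1 -> nat}) :
    seq 'I_k.+1 :=
  [seq j <- enum 'I_k.+1 | critical d a j].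

(* Block i consists of the indices from block_start i to block_end i.  The
   leading 0 of the list below is j_0 + 1 for the convention j_0 = -1. *)
Definition block_start (d : nat -> nat) (k : nat) (a : {ffun 'I_k.+1 -> nat})
    (i : nat) : nat :=
  nth 0 (0 :: [seq (nat_of_ord j).+1 | j <- crits d a]) i.

Definition block_end (d : nat -> nat) (k : nat) (a : {ffun 'I_k.+1 -> nat})
    (i : nat) : nat :=
  nth ord_max (crits d a) i.

Definition ms_block (d : nat -> nat) (k : nat) (a : {ffun 'I_k.+1 -> nat})
    (i : nat) : {ffun 'I_k.+1 -> nat} :=
  [ffun t : 'I_k.+1 =>
     if block_start d a i <= t <= block_end d a i then a t else 0].

Definition dilate (p : nat) (S : set int) : set int :=
  [set (p%:Z * x)%R | x in S].

Definition upto (q : nat) : set int := [set x : int | (0 <= x <= q%:Z)%R].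

Definition represents (s : nat) (X : 'I_s -> set int) (n : int)
    (x : {ffun 'I_s -> int}) : Prop :=
  (forall i, X i (x i)) /\ n = (\sum_(i < s) x i)%R.

Definition direct_sum (s : nat) (S : set int) (X : 'I_s -> set int) : Prop :=
  S = [set n | exists x, represents X n x] /\
  (forall n, S n -> exists! x, represents X n x).

Lemma tok0 d : tok d 0 = 1.
Proof. by rewrite /tok big_ord0. Qed.

Lemma tokS d i : tok d i.+1 = d i * tok d i.
Proof. by rewrite /tok big_ord_recr /= mulnC. Qed.

Lemma tok_dvd d i j : i <= j -> tok d i %| tok d j.
Proof.
move=> /subnK <-; elim: (j - i) => [|m IH]; first by [].
by rewrite addSn tokS dvdn_mull.
Qed.

(* The truncating quotient of ms_sum d (ms_block d a i) by the smallest token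
   value of the block is exact. *)
Lemma dvd_ms_sum_block d k (a : {ffun 'I_k.+1 -> nat}) i :
  tok d (block_start d a i) %| ms_sum d (ms_block d a i).
Proof.
apply: dvdn_sum => t _; rewrite ffunE.
case: ifP => [/andP[le_t _]|_]; last by rewrite mul0n dvdn0.
by rewrite dvdn_mull // tok_dvd.
Qed.

Lemma mem_crits d k (a : {ffun 'I_k.+1 -> nat}) j :
  (j \in crits d a) = critical d a j.
Proof. by rewrite mem_filter mem_enum andbT. Qed.

Lemma crits_sorted d k (a : {ffun 'I_k.+1 -> nat}) :
  sorted ltn [seq nat_of_ord j | j <- crits d a].
Proof.
apply: (subseq_sorted ltn_trans (s2 := iota 0 k.+1)); last exact: iota_ltn_sorted.
by rewrite -val_enum_ord; apply: map_subseq; apply: filter_subseq.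
Qed.

(* Main.v *)
Require Import Defs.
From mathcomp Require Import all_boot all_order all_algebra.
From mathcomp Require Import classical_sets.
From mathcomp Require Import zify.
Import GRing.Theory.

Set Implicit Arguments.
Unset Strict Implicit.
Unset Printing Implicit Defensive.

(** Two facts about a normal collection give the theorem.

    Inside a block, every index but the last is non-critical, so there are at
    least [d t - 1] tokens [p_t].  Since the sum of [(d t - 1) p_t] over
    [l <= t < m] telescopes to [p_m - p_l], the tokens below [p_m] in the block
    already reach [p_m - p_l], and adjoining copies of [p_m] leaves no gap among
    the multiples of [p_l].  Hence the span of the block is the full set of
    multiples of [p_l] up to its sum ([ms_span_gap_free],
    [ms_block_gap_free]).

    Across blocks, normality bounds the sum of all tokens below [p_j] by
    [2 (p_j - 1)]; if [j] is critical and not the last index, at most [d j - 2]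
    tokens [p_j] come on top, and the total stays below [p_(j+1)]
    ([sum_before_block_lt]).  As all the later blocks consist of multiples of
    [p_(j+1)], Euclidean division recovers the contribution of each block from
    the total, starting from the last block ([block_sum_inj]).

    The blocks partition the indices, so choosing a submultiset of [A] amounts
    to choosing one in each block, independently ([ms_span_blocks]). *)

(** * Gap-free multisets *)

(** Brown's criterion for complete sequences, relative to multiples of [P]: if
    each weight in use exceeds the sum of the earlier ones by at most [P], taking
    as many copies of the largest weight as possible leaves a rest within reach
    of the earlier ones.  Indeed, if some copies of [p m] stay unused, the rest
    is a multiple of [P] smaller than [p m], hence at most [p m - P]. *)
Lemma gap_free_subsum (P : nat) (p b : nat -> nat) (m : nat) :
  0 < P ->
  (forall t, t < m -> b t != 0 ->
     [/\ P %| p t, 0 < p t & p t <= P + \sum_(u < t) b u * p u]) ->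
  forall n, P %| n -> n <= \sum_(t < m) b t * p t ->
  exists2 c : nat -> nat, (forall t, t < m -> c t <= b t) &
    n = \sum_(t < m) c t * p t.
Proof.
move=> P_gt0; elim: m => [|m IH] hb n Pn.
  by rewrite !big_ord0 leqn0 => /eqP ->; exists (fun=> 0) => //; rewrite big_ord0.
rewrite big_ord_recr /= => le_n.
set q := minn (b m) (n %/ p m).
have [le_qn Pr le_r] : [/\ q * p m <= n, P %| n - q * p m
    & n - q * p m <= \sum_(t < m) b t * p t].
  have [b0|bN0] := eqVneq (b m) 0.
    rewrite /q b0 min0n mul0n subn0; split=> //.
    by move: le_n; rewrite b0 mul0n addn0.
  have [Pp p_gt0 le_p] := hb m (ltnSn m) bN0.
  have le_qn : q * p m <= n.
    by apply: leq_trans (leq_divM n (p m)); rewrite leq_mul2r geq_minr orbT.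
  have Pr : P %| n - q * p m by rewrite dvdn_sub // dvdn_mull.
  split=> //; have [le_b|lt_b] := leqP (b m) (n %/ p m).
    by rewrite /q (minn_idPl le_b) leq_subLR addnC.
  rewrite /q (minn_idPr (ltnW lt_b)) in Pr *.
  have lt_r : n - n %/ p m * p m < p m.
    by rewrite {1}(divn_eq n (p m)) addKn ltn_pmod.
  case/dvdnP: Pr lt_r => r ->; case/dvdnP: Pp le_p => v ->.
  rewrite ltn_mul2r P_gt0 /= => le_p lt_rv.
  by have := leq_mul lt_rv (leqnn P); rewrite mulSn; lia.
have [|c le_c eq_c] := IH _ (n - q * p m) Pr le_r.
  by move=> t lt_t; apply: hb; apply: ltnW.
exists (fun t => if t < m then c t else q) => [t|].
  by rewrite ltnS leq_eqVlt => /predU1P[->|lt_t];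
    [rewrite ltnn geq_minl | rewrite lt_t le_c].
rewrite big_ord_recr /= ltnn -(subnK le_qn) eq_c; congr (_ + _).
by apply: eq_bigr => t _; rewrite ltn_ord.
Qed.

Lemma Posz_sum (I : Type) (r : seq I) (Q : pred I) (F : I -> nat) :
  Posz (\sum_(i <- r | Q i) F i) = (\sum_(i <- r | Q i) Posz (F i))%R.
Proof. exact: (big_morph Posz PoszD). Qed.

Lemma ms_spanP d k (f : {ffun 'I_k.+1 -> nat}) (n : int) :
  ms_span d f n <->
  exists2 c : {ffun 'I_k.+1 -> nat}, (forall i, c i <= f i) &
    n = Posz (\sum_i c i * tok d i).
Proof.
split=> [[c hc ->]|[c hc ->]].
  exists [ffun i => absz (c i)] => [i|].
    by rewrite ffunE; have := hc i; lia.
  rewrite Posz_sum; apply: eq_bigr => i _; rewrite ffunE PoszM gez0_abs //.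
  by have /andP[] := hc i.
exists [ffun i => Posz (c i)] => [i|]; first by rewrite ffunE; have := hc i; lia.
by rewrite Posz_sum; apply: eq_bigr => i _; rewrite ffunE PoszM.
Qed.

Lemma sum_inord k m (f : {ffun 'I_k.+1 -> nat}) (p : nat -> nat) :
  m <= k.+1 ->
  \sum_(t < m) f (inord t) * p t = \sum_(t < k.+1 | t < m) f t * p t.
Proof.
move=> le_m; rewrite (big_ord_widen _ (fun t => f (inord t) * p t) le_m).
by apply: eq_bigr => t _; rewrite inord_val.
Qed.

(** No multiple of [P] is skipped by [gap_free_subsum]; nothing else occurs,
    since all the tokens in use are multiples of [P]. *)
Lemma ms_span_gap_free d k (f : {ffun 'I_k.+1 -> nat}) P :
  0 < P ->
  (forall t : 'I_k.+1, f t != 0 ->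
     [/\ P %| tok d t, 0 < tok d t &
         tok d t <= P + \sum_(u < k.+1 | u < t) f u * tok d u]) ->
  ms_span d f = dilate P (upto (ms_sum d f %/ P)).
Proof.
move=> P_gt0 hf; apply/seteqP; split=> n.
  case/ms_spanP=> c le_c ->.
  have /dvdnP[q eq_q] : P %| \sum_i c i * tok d i.
    apply: dvdn_sum => i _; have [c0|cN0] := posnP (c i).
      by rewrite c0 mul0n dvdn0.
    rewrite dvdn_mull //; case: (hf i) => //.
    by rewrite -lt0n (leq_trans cN0).
  exists (Posz q); last by rewrite eq_q mulnC PoszM.
  rewrite /upto /= lez_nat leq_divRL // -eq_q.
  by apply: leq_sum => i _; rewrite leq_mul2r le_c orbT.
case=> y; rewrite /upto /= => /andP[y_ge0]; rewrite -(gez0_abs y_ge0) lez_nat.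
rewrite leq_divRL // => le_y <-; rewrite -PoszM mulnC.
have [|||c le_c eq_c] :=
    @gap_free_subsum P (tok d) (fun t => f (inord t)) k.+1 P_gt0 _ (absz y * P).
- move=> t lt_t /hf; rewrite inordK // => -[-> -> le_t]; split=> //.
  by rewrite sum_inord // ltnW.
- exact: dvdn_mull.
- by apply: leq_trans le_y _; apply: leq_sum => t _; rewrite inord_val.
apply/ms_spanP; exists [ffun t : 'I_k.+1 => c t] => [t|].
  by rewrite ffunE -{2}(inord_val t) le_c.
by rewrite eq_c; congr Posz; apply: eq_bigr => t _; rewrite ffunE.
Qed.

(** * Partition of the indices into blocks *)

Section Blocks.

Context (d : nat -> nat) (k : nat) (a : {ffun 'I_k.+1 -> nat}).

Local Notation b := (block_start d a).
Local Notation cs := (crits d a).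
Local Notation s := (size (crits d a)).

Lemma block_start_end i : i < s -> b i.+1 = (block_end d a i).+1.
Proof.
by move=> lt_i; rewrite /block_start /block_end /= (nth_map ord_max).
Qed.

Lemma block_start_lt i j : i < j -> j <= s -> b i < b j.
Proof.
move=> lt_ij le_j; pose bs := 0 :: [seq (nat_of_ord j).+1 | j <- cs].
have bs_sorted : sorted ltn bs.
  rewrite /bs /= (map_comp succn (@nat_of_ord _)) path_min_sorted.
    by rewrite sorted_map; apply: (crits_sorted d a).
  by apply/allP => _ /mapP[t _ ->].
by apply: (sorted_ltn_nth ltn_trans 0 bs_sorted) => //;
  rewrite inE /= size_map ltnS // (leq_trans (ltnW lt_ij)).
Qed.

Lemma block_start_le i j : i <= j -> j <= s -> b i <= b j.
Proof.
by rewrite leq_eqVlt => /predU1P[->//|lt_ij] le_j; apply/ltnW/block_start_lt.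
Qed.

Lemma critical_block_end i : i < s -> critical d a (nth ord_max cs i).
Proof. by move=> lt_i; rewrite -mem_crits mem_nth. Qed.

Lemma not_critical_inside_block i (t : 'I_k.+1) :
  i < s -> b i <= t < block_end d a i -> ~~ critical d a t.
Proof.
move=> lt_i /andP[le_t lt_t]; apply/negP; rewrite -mem_crits => t_cs.
(* A critical [t] would end some block; ending before block [i] puts it below
   [b i], ending block [i] or a later one puts it at least at the end of [i]. *)
have lt_u : index t cs < s by rewrite index_mem.
have eq_u : b (index t cs).+1 = t.+1.
  by rewrite block_start_end // /block_end nth_index.
have [lt_ui|le_iu] := ltnP (index t cs) i.
  by have := block_start_le lt_ui (ltnW lt_i); rewrite eq_u ltnNge le_t.
have := @block_start_le i.+1 (index t cs).+1 le_iu lt_u.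
by rewrite eq_u block_start_end // ltnS leqNgt lt_t.
Qed.

Lemma lt_last_block_start (t : 'I_k.+1) : t < b s.
Proof.
have : ord_max \in cs by rewrite mem_crits /critical eqxx.
rewrite -index_mem => lt_u; have := block_start_le lt_u (leqnn s).
rewrite block_start_end // /block_end nth_index -?index_mem //.
exact: leq_trans.
Qed.

(** Each index below [b m] lies in exactly one of the first [m] blocks, so
    restricting a multiset to these blocks and adding up gives back its part
    below [b m]. *)
Lemma sum_if_block v t m :
  m <= s ->
  \sum_(i < m) (if b i <= t <= block_end d a i then v else 0) =
  if t < b m then v else 0.
Proof.
elim: m => [|m IH] lt_m; first by rewrite big_ord0.
rewrite big_ord_recr /= IH ?(ltnW lt_m) // block_start_end // ltnS.
have := block_start_lt (ltnSn m) lt_m; rewrite block_start_end // ltnS => le_b.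
have [lt_t|le_t] := ltnP t (b m); last by [].
by rewrite addn0 (ltnW (leq_trans lt_t le_b)).
Qed.

Lemma sum_ms_block m : m <= s ->
  \sum_(i < m) ms_sum d (ms_block d a i) =
  \sum_(t < k.+1 | t < b m) a t * tok d t.
Proof.
move=> le_m; rewrite exchange_big [RHS]big_mkcond /=; apply: eq_bigr => t _.
rewrite -(sum_if_block _ t le_m); apply: eq_bigr => i _; rewrite ffunE.
by case: ifP.
Qed.

(** The coefficients can be chosen independently in each block because every
    index lies in exactly one block. *)
Lemma ms_span_blocks (n : int) :
  ms_span d a n <->
  exists x : {ffun 'I_s -> int},
    represents (fun i : 'I_s => ms_span d (ms_block d a i)) n x.
Proof.
split=> [/ms_spanP[c le_c ->]|[x [hx ->]]].
  pose cb i := [ffun t : 'I_k.+1 =>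
    if b i <= t <= block_end d a i then c t else 0].
  exists [ffun i : 'I_s => Posz (\sum_t cb i t * tok d t)]; split=> [i|].
    rewrite ffunE; apply/ms_spanP; exists (cb i) => // t.
    by rewrite !ffunE; case: ifP.
  under [RHS]eq_bigr => i _ do rewrite ffunE.
  rewrite -Posz_sum exchange_big; congr Posz; apply: eq_bigr => t _ /=.
  rewrite -big_distrl /=; congr (_ * _).
  under eq_bigr => i _ do rewrite /cb ffunE.
  by rewrite sum_if_block // lt_last_block_start.
have /fin_all_exists[c hc] : forall i : 'I_s,
    exists c : {ffun 'I_k.+1 -> nat}, (forall t, c t <= ms_block d a i t) /\
      x i = Posz (\sum_t c t * tok d t).
  by move=> i; have /ms_spanP[c le_c eq_c] := hx i; exists c.
apply/ms_spanP; exists [ffun t => \sum_i c i t] => [t|].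
  have <- : \sum_(i < s) ms_block d a i t = a t.
    under eq_bigr => i _ do rewrite ffunE.
    by rewrite sum_if_block // lt_last_block_start.
  by rewrite ffunE; apply: leq_sum => i _; case: (hc i).
rewrite (eq_bigr _ (fun i _ => (hc i).2)) -Posz_sum exchange_big.
by congr Posz; apply: eq_bigr => t _; rewrite ffunE big_distrl.
Qed.

(** * Tokens within a block and before a block *)

Hypothesis d_ge2 : forall i, 2 <= d i.

Lemma tok_gt0 i : 0 < tok d i.
Proof. by rewrite prodn_gt0 // => t; apply: ltnW. Qed.

(** The number of tokens at non-critical indices is large enough for their
    sum to telescope. *)
Lemma tok_le_block_sum i (t : 'I_k.+1) :
  i < s -> b i <= t <= block_end d a i ->
  tok d t <= tok d (b i) + \sum_(u < k.+1 | u < t) ms_block d a i u * tok d u.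
Proof.
move=> lt_i /andP[le_t le_e]; rewrite -sum_inord; last exact: ltnW.
have lt_tk := ltn_ord t; move: (nat_of_ord t) le_t le_e lt_tk => m.
elim: m => [|m IH]; first by rewrite leqn0 => /eqP-> *; apply: leq_addr.
rewrite leq_eqVlt => /predU1P[->|]; first by rewrite leq_addr.
rewrite ltnS => le_bm lt_me /ltnW lt_mk; rewrite big_ord_recr /= addnA.
rewrite ffunE inordK // le_bm (ltnW lt_me) /= tokS.
have : ~~ critical d a (inord m).
  by apply: (@not_critical_inside_block i) => //; rewrite inordK // le_bm.
rewrite /critical negb_or -leqNgt inordK // => /andP[_ le_a].
have : d m * tok d m <= (a (inord m)).+1 * tok d m by rewrite leq_mul2r; lia.
rewrite mulSn => /leq_trans; apply; rewrite leq_add2r.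
exact: IH le_bm (ltnW lt_me) lt_mk.
Qed.

Lemma ms_block_gap_free i : i < s ->
  ms_span d (ms_block d a i) =
  dilate (tok d (b i)) (upto (ms_sum d (ms_block d a i) %/ tok d (b i))).
Proof.
move=> lt_i; apply: ms_span_gap_free => [|t]; first exact: tok_gt0.
rewrite ffunE; case: ifP => // in_t _; split; last exact: tok_le_block_sum.
  by apply: tok_dvd; case/andP: in_t.
exact: tok_gt0.
Qed.

Hypothesis a_normal : ms_normal d a.

(** The sum of the [2 (d t - 1) p_t] telescopes to [2 (p_m - 1)]; the constant
    is moved to the left to avoid truncated subtraction. *)
Lemma sum_normal_le m : m <= k.+1 ->
  \sum_(t < m) a (inord t) * tok d t + 2 <= 2 * tok d m.
Proof.
elim: m => [|m IH] lt_m; first by rewrite big_ord0 tok0.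
rewrite big_ord_recr /= tokS; have := IH (ltnW lt_m).
have := a_normal (inord m); rewrite inordK // => le_a.
have := leq_mul le_a (leqnn (tok d m)); have := d_ge2 m.
rewrite -mulnA mulnBl mul1n => d2; have := leq_mul d2 (leqnn (tok d m)).
move: (\sum_(t < m) _) => S; lia.
Qed.

(** A block that is not the last one ends at an index [j] with at most
    [d j - 2] tokens [p_j]; together with the bound [2 (p_j - 1)] on the
    tokens below, the sum is at most [d j * p_j - 2]. *)
Lemma sum_before_block_lt i : i < s ->
  \sum_(m < i) ms_sum d (ms_block d a m) < tok d (b i).
Proof.
case: i => [|i] lt_i; first by rewrite big_ord0 tok_gt0.
rewrite sum_ms_block ?(ltnW lt_i) //.
have := critical_block_end (ltnW lt_i).
have := block_start_lt (ltnSn i.+1) lt_i.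
rewrite !block_start_end ?(ltnW lt_i) // /block_end.
set j := nth _ _ i; set j' := nth _ _ i.+1; rewrite ltnS => lt_jj'.
have jN : j != ord_max.
  by rewrite -val_eqE /= neq_ltn (leq_trans lt_jj') // -ltnS.
rewrite /critical (negPf jN) /= => lt_a.
rewrite -sum_inord // big_ord_recr /= inord_val tokS.
have := sum_normal_le (ltnW (ltn_ord j)).
have : (a j).+2 * tok d j <= d j * tok d j by rewrite leq_mul2r; lia.
by rewrite !mulSn; move: (\sum_(t < j) _) => S; lia.
Qed.

End Blocks.

(** * Uniqueness *)

(** The last summand is a multiple of its [P], while the sum of the others lies
    in [0, P): both are determined by the total, as quotient and remainder. The
    earlier summands are then recovered in the same way. *)
Lemma block_sum_inj s (P N : nat -> nat) (x y : 'I_s -> int) :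
  (forall i, i < s -> \sum_(m < i) N m < P i) ->
  (forall i : 'I_s, dilate (P i) (upto (N i %/ P i)) (x i)) ->
  (forall i : 'I_s, dilate (P i) (upto (N i %/ P i)) (y i)) ->
  (\sum_i x i = \sum_i y i)%R -> x =1 y.
Proof.
elim: s x y => [|s IH] x y lt_NP hx hy; first by move=> _ [].
have bound (z : 'I_s.+1 -> int) :
    (forall i : 'I_s.+1, dilate (P i) (upto (N i %/ P i)) (z i)) ->
    (0 <= \sum_(i < s) z (widen_ord (leqnSn s) i) < (P s)%:Z)%R.
  move=> hz; have zP i : (0 <= z i <= (N i)%:Z)%R.
    have [v /= /andP[v_ge0 le_v] <-] := hz i.
    have := leq_divM (N i) (P i); nia.
  apply/andP; split.
    apply: Num.Theory.sumr_ge0 => i _.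
    by case/andP: (zP (widen_ord (leqnSn s) i)).
  apply: Order.POrderTheory.le_lt_trans (_ : ((\sum_(m < s) N m)%N%:Z < _)%R).
    rewrite Posz_sum; apply: Num.Theory.ler_sum => i _.
    by case/andP: (zP (widen_ord (leqnSn s) i)).
  by rewrite ltz_nat lt_NP.
rewrite !big_ord_recr /= => eq_xy.
have eq_last : x ord_max = y ord_max.
  move: (bound x hx) (bound y hy) eq_xy.
  have [v /= _ <-] := hx ord_max; have [w /= _ <-] := hy ord_max.
  move: (\sum_(i < s) _)%R (\sum_(i < s) _)%R => A B A_lt B_lt eq_AB.
  by have -> : v = w by nia.
have eq_init : (fun i => x (widen_ord (leqnSn s) i)) =1
               (fun i => y (widen_ord (leqnSn s) i)).
  apply: IH => [i lt_i|i|i|]; [by apply/lt_NP/ltnW| | |].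
  - exact: hx (widen_ord _ i).
  - exact: hy (widen_ord _ i).
  -
  by move: eq_xy; rewrite eq_last => /addIr.
move=> i; have [lt_i|] := ltnP i s.
  have -> : i = widen_ord (leqnSn s) (Ordinal lt_i) by apply: val_inj.
  exact: eq_init.
move=> le_i; have -> : i = ord_max.
  by apply/val_inj/eqP; rewrite eqn_leq -ltnS ltn_ord.
exact: eq_last.
Qed.

Theorem theorem3p1 (d : nat -> nat) (k : nat) (a : {ffun 'I_k.+1 -> nat}) :
  (forall i : nat, 2 <= d i) ->
  a ord_max != 0 ->
  ms_normal d a ->
  direct_sum (ms_span d a)
    (fun i : 'I_(size (crits d a)) =>
       dilate (tok d (block_start d a i))
         (upto (ms_sum d (ms_block d a i) %/ tok d (block_start d a i)))).
Proof.
move=> d_ge2 _ a_normal.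
have blockE n x : represents (fun i : 'I_(size (crits d a)) =>
      ms_span d (ms_block d a i)) n x <->
    represents (fun i : 'I_(size (crits d a)) =>
      dilate (tok d (block_start d a i))
        (upto (ms_sum d (ms_block d a i) %/ tok d (block_start d a i)))) n x.
  by split=> -[hx ->]; split=> // i; have := hx i; rewrite ms_block_gap_free.
have spanE n : ms_span d a n <-> exists x, represents
    (fun i : 'I_(size (crits d a)) => dilate (tok d (block_start d a i))
       (upto (ms_sum d (ms_block d a i) %/ tok d (block_start d a i)))) n x.
  by rewrite ms_span_blocks; split=> -[x /blockE]; exists x.
split; first by apply/seteqP; split=> n /spanE.
move=> n /spanE[x [hx eq_x]]; exists x; split=> // y [hy eq_y].
apply/ffunP; apply: (block_sum_inj (P := fun i => tok d (block_start d a i))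
  (N := fun i => ms_sum d (ms_block d a i))) => //; last by rewrite -eq_x.
by move=> i lt_i; apply: sum_before_block_lt.
Qed.
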